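(* Consider a Markov chain with state $z=(z_1,\dots,z_n)\in\mathcal Z=\mathcal Z_1\times\cdots\times\mathcal Z_n$, where each $\mathcal Z_i$ is a finite set. Suppose its transition probability factorizes as \[P(z(t+1)|z(t))=\prod_{i=1}^nP_i(z_i(t+1)|z_{N_i}(t)),\] and suppose $\sup_{1\le i\le n}\sum_{j=1}^nC^z_{ij}\le\rho$, where \[C_{ij}^z=\begin{cases}0,&j\notin N_i,\\ \sup_{z_{N_i\setminus j}}\ \sup_{z_j,z_j'}\mathrm{TV}\big(P_i(\cdot|z_j,z_{N_i\setminus j}),P_i(\cdot|z_j',z_{N_i\setminus j})\big),&j\in N_i.\end{cases}\] Then for any $i$, any integer $\kappa\ge1$, and any $z=(z_{N_i^\kappa},z_{N_{-i}^\kappa})$, $\tilde z=(z_{N_i^\kappa},\tilde z_{N_{-i}^\kappa})$ in $\mathcal Z$ (agreeing on $N_i^\kappa$), \[\mathrm{TV}(\pi_{t,i},\tilde\pi_{t,i})=0\ \text{ for } t\le\kappa,\qquad \mathrm{TV}(\pi_{t,i},\tilde\pi_{t,i})\le\rho^t\ \text{ for } t>\kappa,\] where $\pi_{t,i}$ is the distribution of $z_i(t)$ given $z(0)=z$, and $\tilde\pi_{t,i}$ is the distribution of $z_i(t)$ given $z(0)=\tilde z$.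
   Context: An undirected graph on the vertex set $\mathcal N=\{1,\dots,n\}$ is fixed. $N_i$ is the set consisting of $i$ and its neighbours; $N_i^\kappa$ is the set of nodes at graph distance at most $\kappa$ from $i$ (including $i$), and $N_{-i}^\kappa=\mathcal N\setminus N_i^\kappa$. For $M\subset\mathcal N$, $z_M$ denotes the coordinates of $z$ indexed by $M$. $\mathrm{TV}(\mu,\nu)=\sup_A|\mu(A)-\nu(A)|$. *)

(* Defs.v *)
From HB Require Import structures.
From mathcomp Require Import all_boot all_order all_algebra.
From mathcomp Require Import boolp classical_sets reals.
Set Implicit Arguments.
Unset Strict Implicit.
Unset Printing Implicit Defensive.
Import Order.TTheory GRing.Theory Num.Theory.

Local Open Scope ring_scope.

(* An undirected graph is a symmetric relation [e] on ['I_n]. Loops are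
   allowed: they change neither the neighbourhoods nor the distances below. *)

Definition nbhd (n : nat) (e : rel 'I_n) (i : 'I_n) : {set 'I_n} :=
  finset (fun j => (j == i) || e i j).

Definition walk (n : nat) (e : rel 'I_n) (i j : 'I_n) (d : nat) : bool :=
  [exists p : d.-tuple 'I_n, path e i p && (last i p == j)].

(* A relation rather than a function, so that nodes in different connected
   components are at no finite distance. *)
Definition at_dist (n : nat) (e : rel 'I_n) (i j : 'I_n) (d : nat) : bool :=
  walk e i j d && [forall m : 'I_d, ~~ walk e i j m].

Definition kappa_nbhd (n : nat) (e : rel 'I_n) (kappa : nat) (i : 'I_n) :
    {set 'I_n} :=
  finset (fun j => [exists d : 'I_kappa.+1, at_dist e i j d]).

Definition state (n : nat) (Z : 'I_n -> finType) : finType :=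
  {dffun forall i : 'I_n, Z i}.

Definition local_state (n : nat) (Z : 'I_n -> finType) (M : {set 'I_n}) :
    finType :=
  {dffun forall j : {j : 'I_n | j \in M}, Z (val j)}.

Definition restr (n : nat) (Z : 'I_n -> finType) (M : {set 'I_n})
    (z : state Z) : local_state Z M :=
  [ffun j : {j : 'I_n | j \in M} => z (val j) : Z (val j)].

Definition is_pmf (R : realType) (T : finType) (p : T -> R) : Prop :=
  (forall x, 0 <= p x) /\ \sum_x p x = 1.

Definition TV (R : realType) (T : finType) (p q : T -> R) : R :=
  sup (range (fun A : {set T} =>
    `|\sum_(x in A) p x - \sum_(x in A) q x|)).

(* A configuration of the coordinates in [nbhd e i] other than [j], together
   with two values of coordinate [j], is encoded as a pair [u], [v] of local
   states that agree away from [j]. *)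
Definition influence (R : realType) (n : nat) (e : rel 'I_n)
    (Z : 'I_n -> finType)
    (Ploc : forall i : 'I_n, local_state Z (nbhd e i) -> Z i -> R)
    (i j : 'I_n) : R :=
  if j \in nbhd e i then
    sup [set r : R | exists u v : local_state Z (nbhd e i),
      (forall k, val k != j -> u k = v k) /\ r = TV (Ploc i u) (Ploc i v)]%classic
  else 0.

(* The law of the state at time [t] of the chain with transition probability
   [P], where [P x y] is the probability to go from [x] to [y], started at
   [z]. *)
Fixpoint law (R : realType) (S : finType) (P : S -> S -> R) (z : S) (t : nat) :
    S -> R :=
  if t is t'.+1 then fun y => \sum_x law P z t' x * P x y
  else fun y => (y == z)%:R.

Definition coord_law (R : realType) (n : nat) (Z : 'I_n -> finType)
    (P : state Z -> state Z -> R) (z : state Z) (t : nat) (i : 'I_n) :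
    Z i -> R :=
  fun a => \sum_(y : state Z | y i == a) law P z t y.

Arguments coord_law {R n Z} P z t i.

(* Main.v *)
(* By duality, follow the oscillations of a test function [g] under
   [g |-> sum_y P x y * g y], instead of the laws. Replacing the factors of a
   product measure one at a time shows that the oscillation of the image of [g]
   in coordinate [j] is at most [sum_k osc_k(g) * C k j]. Starting from the
   indicator of an event on coordinate [i], the oscillation after [t] steps is
   thus at most the entry [(i, j)] of [C ^ t]. Summing over the coordinates [j]
   at which the two initial states differ bounds the total variation distance.
   The rows of [C ^ t] sum to at most [rho ^ t], and the entry [(i, j)] vanishes
   unless a walk of length at most [t] leads from [i] to [j]. *)

Require Import Defs.
From HB Require Import structures.
From mathcomp Require Import all_boot all_order all_algebra.
From mathcomp Require Import boolp classical_sets reals.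
Set Implicit Arguments.
Unset Strict Implicit.
Unset Printing Implicit Defensive.
Import Order.TTheory GRing.Theory Num.Theory.
Local Open Scope ring_scope.

Lemma has_ubound_range_fin (R : realType) (T : finType) (f : T -> R) :
  has_ubound (range f).
Proof.
exists (\sum_x `|f x|) => _ [x _ <-].
rewrite (bigD1 x) //= (le_trans (ler_norm _)) // lerDl.
by apply: sumr_ge0.
Qed.

Lemma le_sup_range_fin (R : realType) (T : finType) (f : T -> R) (x : T) :
  f x <= sup (range f).
Proof. by apply: ub_le_sup; [exact: has_ubound_range_fin | exists x]. Qed.

(** * Total variation on a finite type *)

Section TotalVariation.
Variables (R : realType) (T : finType).
Implicit Types p q g : T -> R.

Lemma TV_ge p q (A : {set T}) :
  `|\sum_(x in A) p x - \sum_(x in A) q x| <= TV p q.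
Proof.
exact: (le_sup_range_fin
  (fun A : {set T} => `|\sum_(x in A) p x - \sum_(x in A) q x|)).
Qed.

Lemma TV_ge0 p q : 0 <= TV p q.
Proof. by apply: le_trans (TV_ge p q finset.set0); rewrite normr_ge0. Qed.

Lemma TV_le p q c :
  (forall A : {set T}, `|\sum_(x in A) p x - \sum_(x in A) q x| <= c) ->
  TV p q <= c.
Proof.
move=> le_c; apply: ge_sup => [|_ [A _ <-]//].
pose A0 : {set T} := finset.set0.
by exists `|\sum_(x in A0) p x - \sum_(x in A0) q x|, A0.
Qed.

Lemma TVxx p : TV p p = 0.
Proof.
apply/eqP; rewrite eq_le TV_ge0 andbT; apply: TV_le => A.
by rewrite subrr normr0.
Qed.

(** As the masses agree, [g] may be lowered by its minimum. It then takes values between 0 and [c],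
    and dropping the points with [p x < q x] only increases the sum; what is left is at most [c]
    times the excess of [p] over [q] on one event. *)
Lemma ler_sum_osc_TV p q g c (x0 : T) : \sum_x p x = \sum_x q x ->
  (forall x y, g x - g y <= c) ->
  \sum_x p x * g x - \sum_x q x * g x <= c * TV p q.
Proof.
move=> pq osc_g.
have [m _ g_min] := @Order.TotalTheory.arg_minP _ _ _ x0 xpredT g isT.
have c_ge0 : 0 <= c by rewrite -(subrr (g x0)).
pose A := [set x | q x <= p x]%SET.
have -> : \sum_x p x * g x - \sum_x q x * g x
        = \sum_x (p x - q x) * (g x - g m).
  under [RHS]eq_bigr do rewrite mulrBr.
  rewrite [RHS]sumrB -mulr_suml [in RHS]sumrB pq subrr mul0r subr0 -sumrB.
  by under eq_bigr do rewrite -mulrBl.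
apply: (@le_trans _ _ (\sum_(x in A) (p x - q x) * (g x - g m))).
  rewrite (bigID (mem A)) /= gerDl; apply: sumr_le0 => x.
  rewrite inE -ltNge => /ltW pq_x.
  by rewrite mulr_le0_ge0 ?subr_le0 ?subr_ge0 ?g_min.
apply: (@le_trans _ _ (\sum_(x in A) c * (p x - q x))).
  by apply: ler_sum => x; rewrite inE => qp_x; rewrite mulrC ler_wpM2r ?subr_ge0.
rewrite -mulr_sumr ler_wpM2l // sumrB.
exact: le_trans (ler_norm _) (TV_ge _ _ _).
Qed.
End TotalVariation.

(** * Product measures and coordinatewise oscillation *)

Section ProductMeasures.
Variables (R : realType) (n : nat) (Z : 'I_n -> finType).
Implicit Types (p q : forall i, Z i -> R) (g : state Z -> R) (y : state Z).

Definition upd k (a : Z k) y : state Z := [ffun i => dfwith y a i].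
Arguments upd : clear implicits.

Definition agree_off k (x y : state Z) := forall i, i != k -> x i = y i.

Lemma upd_same k (a : Z k) y : upd k a y k = a.
Proof. by rewrite ffunE dfwith_in. Qed.

Lemma upd_other k (a : Z k) y : agree_off k (upd k a y) y.
Proof. by move=> i ik; rewrite ffunE dfwith_out // eq_sym. Qed.

Lemma agree_off_eq k x y : agree_off k x y -> x k = y k -> x = y.
Proof.
move=> xy xyk; apply/ffunP => i.
by have [->//|/xy] := eqVneq i k.
Qed.

Lemma agree_off_upd k (a b : Z k) y : agree_off k (upd k a y) (upd k b y).
Proof. by move=> i ik; rewrite !upd_other. Qed.

Lemma sum_state_coord k (a0 : Z k) g :
  \sum_y g y = \sum_(y : state Z | y k == a0) \sum_a g (upd k a y).
Proof.
rewrite pair_big /=.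
(* The inverse map records [y k] and resets coordinate [k] to [a0]. *)
rewrite (reindex_onto (fun u : state Z * Z k => upd k u.2 u.1)
  (fun y => (upd k a0 y, y k))) /=; last first.
  move=> y _; apply: (@agree_off_eq k); last by rewrite upd_same.
  by move=> i ik; rewrite !upd_other.
apply: eq_bigl => -[y a] /=; rewrite andbT.
apply/eqP/eqP => [[<- _]|yk]; first by rewrite upd_same.
congr pair; last by rewrite upd_same.
apply: (@agree_off_eq k); last by rewrite upd_same.
by move=> i ik; rewrite !upd_other.
Qed.

Definition prodm p y : R := \prod_i p i (y i).

Lemma prodm_upd p k (a : Z k) y :
  prodm p (upd k a y) = p k a * \prod_(i | i != k) p i (y i).
Proof.
rewrite /prodm (bigD1 k) //= upd_same; congr (_ * _).
by apply: eq_bigr => i ik; rewrite upd_other.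
Qed.

(* The slice [y k = a0], for an arbitrary reference value [a0], parametrizes the
   configurations of the coordinates other than [k]. *)
Lemma sum_prodm_coord p k (a0 : Z k) g :
  \sum_y prodm p y * g y =
  \sum_(y : state Z | y k == a0)
    (\prod_(i | i != k) p i (y i)) * \sum_a p k a * g (upd k a y).
Proof.
rewrite (sum_state_coord a0); apply: eq_bigr => y _.
rewrite mulr_sumr; apply: eq_bigr => a _.
by rewrite prodm_upd mulrCA mulrA.
Qed.

Lemma sum_prodm_slice p k (a0 : Z k) : \sum_a p k a = 1 ->
  \sum_y prodm p y =
  \sum_(y : state Z | y k == a0) \prod_(i | i != k) p i (y i).
Proof.
move=> pk1.
under [LHS]eq_bigr do rewrite -[prodm _ _]mulr1.
rewrite (sum_prodm_coord p a0 (fun=> 1)); apply: eq_bigr => y _.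
suff -> : \sum_a p k a * 1 = 1 by rewrite mulr1.
by rewrite -mulr_suml mulr1.
Qed.

Lemma prod_off_eq p q k y : (forall i, i != k -> p i = q i) ->
  \prod_(i | i != k) p i (y i) = \prod_(i | i != k) q i (y i).
Proof. by move=> pq; apply: eq_bigr => i /pq ->. Qed.

(** Both masses equal the same sum over a slice. This carries total mass 1 along the intermediate
    measures of [ler_prodm_osc]. *)
Lemma sum_prodm_change_coord p q k : (forall i, i != k -> p i = q i) ->
  \sum_a p k a = 1 -> \sum_a q k a = 1 ->
  \sum_y prodm p y = 1 -> \sum_y prodm q y = 1.
Proof.
move=> pq pk qk p1.
(* If [Z k] were empty, [p k] would have mass 0, not 1. *)
have [a0|Zk0] := pickP (Z k); last first.
  by move: pk; rewrite big_pred0 // => /esym/eqP; rewrite oner_eq0.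
move=> _; move: p1; rewrite !(sum_prodm_slice a0) //.
by under eq_bigr do rewrite (prod_off_eq _ pq).
Qed.

(** The weights of the other coordinates are common to both measures, so at each point of a slice
    [ler_sum_osc_TV] applies to coordinate [k] alone. *)
Lemma ler_prodm_change_coord p q k g c : (forall i, i != k -> p i = q i) ->
  (forall i a, 0 <= p i a) -> \sum_a p k a = 1 -> \sum_a q k a = 1 ->
  \sum_y prodm p y = 1 -> (forall x y, agree_off k x y -> g x - g y <= c) ->
  \sum_y prodm p y * g y - \sum_y prodm q y * g y <= c * TV (p k) (q k).
Proof.
move=> pq p_ge0 pk qk p1 osc_g.
have [a0|Zk0] := pickP (Z k); last first.
  by move: pk; rewrite big_pred0 // => /esym/eqP; rewrite oner_eq0.
rewrite !(sum_prodm_coord _ a0) -sumrB => _.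
(* The factor 1 is expanded into the slice weights, so that both sides compare term by term. *)
rewrite -[leRHS]mul1r -[X in _ <= X * _]p1 (sum_prodm_slice a0) //.
rewrite mulr_suml.
apply: ler_sum => y _; rewrite -(prod_off_eq _ pq) -mulrBr.
rewrite ler_wpM2l ?prodr_ge0 //; apply: ler_sum_osc_TV => //.
  by rewrite pk qk.
by move=> a b; apply/osc_g/agree_off_upd.
Qed.

(** One-sided differences suffice, since [agree_off] is symmetric. *)
Definition osc_le g (D : 'I_n -> R) :=
  forall k x y, agree_off k x y -> g x - g y <= D k.

Lemma ler_prodm_osc p q g D (s : seq 'I_n) : uniq s ->
  (forall i, i \notin s -> p i = q i) ->
  (forall i, is_pmf (p i)) -> (forall i, is_pmf (q i)) ->
  \sum_y prodm p y = 1 -> osc_le g D ->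
  \sum_y prodm p y * g y - \sum_y prodm q y * g y
    <= \sum_(k <- s) D k * TV (p k) (q k).
Proof.
move=> + + + q_pmf + osc_g.
elim: s p => [|k s IHs] p.
  move=> _ pq _ _; rewrite big_nil.
  have -> : p = q by apply: functional_extensionality_dep => i; exact: pq.
  by rewrite subrr.
case/andP=> ks uniq_s pq p_pmf p1; rewrite big_cons.
(* Intermediate measure: it differs from [p] at most in factor [k], and from [q] at most on the
   remaining list [s]. *)
pose r i := if i == k then q i else p i.
have pr i : i != k -> p i = r i by rewrite /r => /negbTE ->.
have rk : r k = q k by rewrite /r eqxx.
have r_pmf i : is_pmf (r i) by rewrite /r; case: ifP.
have r1 : \sum_y prodm r y = 1.
  by apply: (sum_prodm_change_coord pr) => //; [case: (p_pmf k)|case: (r_pmf k)].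
rewrite -(subrKA (\sum_y prodm r y * g y)); apply: lerD.
  rewrite -rk; apply: ler_prodm_change_coord => //.
  - by move=> i a; case: (p_pmf i).
  - by case: (p_pmf k).
  - by case: (r_pmf k).
  - by move=> x y; exact: osc_g.
(* Uniqueness keeps [k] out of [s], so the replacement leaves these terms unchanged. *)
have -> : \sum_(j <- s) D j * TV (p j) (q j) = \sum_(j <- s) D j * TV (r j) (q j).
  apply: eq_big_seq => j js; rewrite -pr //.
  by apply: contraNneq ks => <-.
apply: IHs => // i i_s; rewrite /r; case: eqVneq => // ik.
by apply: pq; rewrite inE negb_or ik.
Qed.

(** Telescoping: the coordinates in [s] are moved one at a time to their values in [y]. *)
Lemma ler_sub_osc g D (x y : state Z) (s : seq 'I_n) :
  (forall i, i \notin s -> x i = y i) -> osc_le g D ->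
  g x - g y <= \sum_(k <- s) D k.
Proof.
move=> + osc_g; elim: s x => [|k s IHs] x xy.
  have -> : x = y by apply/ffunP => i; exact: xy.
  by rewrite subrr big_nil.
rewrite big_cons -(subrKA (g (upd k (y k) x))); apply: lerD.
  by apply: osc_g => i ik; rewrite upd_other.
apply: IHs => i i_s; have [->|ik] := eqVneq i k; first by rewrite upd_same.
by rewrite upd_other // xy // inE negb_or ik.
Qed.
End ProductMeasures.

(** * The influence matrix, its powers, and walks *)

Section Influence.
Variables (R : realType) (n : nat) (e : rel 'I_n) (Z : 'I_n -> finType).
Variable Ploc : forall i : 'I_n, local_state Z (nbhd e i) -> Z i -> R.
Local Notation C := (influence Ploc).

Lemma influence_ge i j (u v : local_state Z (nbhd e i)) :
  j \in nbhd e i -> (forall k, val k != j -> u k = v k) ->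
  TV (Ploc u) (Ploc v) <= C i j.
Proof.
move=> ji uv; rewrite /influence ji; apply: ub_le_sup; last by exists u, v.
(* The supremum is over the values of a function on finitely many pairs of local states, hence
   bounded. *)
have [b b_ub] := has_ubound_range_fin
  (fun w : local_state Z (nbhd e i) * local_state Z (nbhd e i) =>
     TV (Ploc w.1) (Ploc w.2)).
by exists b => _ [u' [v' [_ ->]]]; apply: b_ub; exists (u', v').
Qed.

Lemma influence_ge0 (z : state Z) i j : 0 <= C i j.
Proof.
have [ji|/negbTE ji] := boolP (j \in nbhd e i); last by rewrite /influence ji.
by rewrite -(TVxx (Ploc (restr (nbhd e i) z))) influence_ge.
Qed.

Lemma TV_restr_le (x y : state Z) i j : agree_off j x y ->
  TV (Ploc (restr (nbhd e i) x)) (Ploc (restr (nbhd e i) y)) <= C i j.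
Proof.
move=> xy; have [ji|ji] := boolP (j \in nbhd e i).
  by apply: influence_ge => // k kj; rewrite !ffunE xy.
have -> : restr (nbhd e i) x = restr (nbhd e i) y.
  apply/ffunP => k; rewrite !ffunE xy //.
  by apply: contraNneq ji => <-; exact: valP.
by rewrite TVxx (influence_ge0 x).
Qed.

(** Row [i] of the matrix power [C ^ t]; multiplying on the right matches the recursion in
    [osc_le_expect_next]. *)
Fixpoint influence_pow (i : 'I_n) (t : nat) (j : 'I_n) : R :=
  if t is t'.+1 then \sum_k influence_pow i t' k * C k j else (j == i)%:R.

Lemma influence_pow_ge0 (z : state Z) i t j : 0 <= influence_pow i t j.
Proof.
elim: t j => [|t IHt] j /=; first exact: ler0n.
by apply: sumr_ge0 => k _; rewrite mulr_ge0 // (influence_ge0 z).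
Qed.

Lemma sum_influence_pow_le (z : state Z) rho i t :
  (forall k, \sum_j C k j <= rho) -> \sum_j influence_pow i t j <= rho ^+ t.
Proof.
move=> C_rho; elim: t => [|t IHt] /=.
  rewrite (bigD1 i) //= eqxx big1 ?addr0 // => j /negbTE -> //.
(* The sign allows the induction hypothesis to be multiplied by [rho]. *)
have rho_ge0 : 0 <= rho.
  apply: le_trans (C_rho i); apply: sumr_ge0 => j _; exact: (influence_ge0 z).
rewrite exchange_big /= exprSr.
apply: le_trans (ler_wpM2r rho_ge0 IHt); rewrite mulr_suml.
apply: ler_sum => k _; rewrite -mulr_sumr.
by rewrite ler_wpM2l // (influence_pow_ge0 z).
Qed.

Lemma walk_rcons i j k d :
  walk e i k d -> e k j -> walk e i j d.+1.
Proof.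
case/existsP=> p /andP[pth /eqP lst] ekj.
by apply/existsP; exists (rcons_tuple p j);
  rewrite /= rcons_path last_rcons pth lst ekj eqxx.
Qed.

(** A nonzero entry has a nonzero term [k]. The factor [C k j] then either extends the walk by an
    edge or, when [j = k], leaves it as it is; hence a length at most [t]. *)
Lemma influence_pow_walk i t j : influence_pow i t j != 0 ->
  exists2 d, (d <= t)%N & walk e i j d.
Proof.
elim: t j => [|t IHt] j /=.
  have [-> _|_] := eqVneq j i; last by rewrite eqxx.
  by exists 0%N => //; apply/existsP; exists [tuple]; rewrite /= eqxx.
move=> s_neq0.
have [k] : exists k, influence_pow i t k * C k j != 0.
  apply/existsP; apply: contraNT s_neq0; rewrite negb_exists => /forallP s0.
  by rewrite big1 // => k _; apply/eqP; rewrite -[_ == _]negbK.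
rewrite mulf_eq0 negb_or => /andP[/IHt[d dt wd]].
rewrite /influence inE; have [->_|_] := eqVneq j k.
  by exists d => //; exact: leqW.
have [ekj _|_] := boolP (e k j); last by rewrite eqxx.
by exists d.+1 => //; exact: walk_rcons ekj.
Qed.

Lemma walk_kappa_nbhd kappa i j d : (d <= kappa)%N -> walk e i j d ->
  j \in kappa_nbhd e kappa i.
Proof.
move=> dk wd; have exd : exists m, walk e i j m by exists d.
(* Distance is the length of a shortest walk, so a minimal length is chosen. *)
have [m wm m_min] := ex_minnP exd.
have mk : (m < kappa.+1)%N by rewrite ltnS (leq_trans (m_min _ wd)).
rewrite inE; apply/existsP; exists (Ordinal mk); rewrite /at_dist wm /=.
by apply/forallP => l; apply/negP => /m_min; rewrite leqNgt ltn_ord.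
Qed.

(** * Oscillations along the chain *)

Section Chain.
Variable P : state Z -> state Z -> R.
Hypothesis P_pmf : forall x : state Z, is_pmf (P x).
Hypothesis Ploc_pmf : forall (i : 'I_n) (u : local_state Z (nbhd e i)),
  is_pmf (Ploc u).
Hypothesis P_factor : forall x y : state Z,
  P x y = \prod_(i < n) Ploc (restr (nbhd e i) x) (y i).

Definition expect_next (g : state Z -> R) (x : state Z) : R :=
  \sum_y P x y * g y.

(** Duality: the last step in time is the first one applied to [g]. *)
Lemma sum_law z t g :
  \sum_y law P z t y * g y = iter t expect_next g z.
Proof.
elim: t g => [|t IHt] g.
  rewrite (bigD1 z) //= eqxx mul1r big1 ?addr0 // => y /negbTE -> .
  by rewrite mul0r.
rewrite iterSr -IHt /=.
under eq_bigr do rewrite mulr_suml.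
rewrite exchange_big; apply: eq_bigr => x _; rewrite mulr_sumr.
by apply: eq_bigr => y _; rewrite mulrA.
Qed.

(** The next-step laws from [x] and [y] are product measures, whose factors at [k] are within
    [C k j] of each other when [x] and [y] agree off [j]. *)
Lemma osc_le_expect_next g D : (forall k, 0 <= D k) -> osc_le g D ->
  osc_le (expect_next g) (fun j => \sum_k D k * C k j).
Proof.
move=> D_ge0 osc_g j x y xy.
pose m (w : state Z) k := Ploc (restr (nbhd e k) w).
have expE w : expect_next g w = \sum_v prodm (m w) v * g v.
  by apply: eq_bigr => v _; rewrite P_factor.
rewrite !expE; apply: (@le_trans _ _ (\sum_k D k * TV (m x k) (m y k))).
  apply: ler_prodm_osc => //.
  - exact: index_enum_uniq.
  - by move=> k; rewrite mem_index_enum.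
  - by move=> k; exact: Ploc_pmf.
  - by move=> k; exact: Ploc_pmf.
  - have [_ <-] := P_pmf x.
    by apply: eq_bigr => v _; rewrite P_factor.
by apply: ler_sum => k _; rewrite ler_wpM2l // TV_restr_le.
Qed.

Lemma osc_le_iter_expect_next i t g : osc_le g (influence_pow i 0) ->
  osc_le (iter t expect_next g) (influence_pow i t).
Proof.
move=> osc_g; elim: t => [//|t IHt]; rewrite iterS.
move=> j x y xy; apply: osc_le_expect_next xy => // k.
exact: influence_pow_ge0 x _ _ _.
Qed.

Lemma TV_coord_law_le z z' t i :
  TV (coord_law P z t i) (coord_law P z' t i)
    <= \sum_(j | z j != z' j) influence_pow i t j.
Proof.
apply: TV_le => A.
pose g (y : state Z) : R := (y i \in A)%:R.
have coordE w : \sum_(a in A) coord_law P w t i a = iter t expect_next g w.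
  rewrite -sum_law /coord_law (exchange_big_dep xpredT) //=.
  apply: eq_bigr => y _; rewrite /g.
  have [yA|yA] := boolP (y i \in A); last first.
    by rewrite mulr0 big1 // => a /andP[aA /eqP ya]; rewrite ya aA in yA.
  rewrite mulr1 (big_pred1 (y i)) // => a.
  by rewrite /= eq_sym; case: eqP => [->|_]; rewrite ?yA ?andbF.
(* The indicator varies by at most 1 and only with coordinate [i]: row [i] of the identity
   matrix. *)
have osc_g : osc_le g (influence_pow i 0).
  move=> j x y xy; rewrite /g /=.
  have [_|ji] := eqVneq j i; last by rewrite xy ?subrr 1?eq_sym.
  by rewrite lerBlDr -natrD ler_nat; case: (_ \in A); case: (_ \in A).
have osc_t := osc_le_iter_expect_next t osc_g.
have dist_le x y : iter t expect_next g x - iter t expect_next g y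
    <= \sum_(j | x j != y j) influence_pow i t j.
  rewrite -big_filter; apply: ler_sub_osc => // k.
  by rewrite mem_filter mem_index_enum andbT negbK => /eqP.
rewrite !coordE ler_norml lerNl opprB dist_le andbT.
(* The opposite sign is the same bound with the initial states exchanged. *)
by under eq_bigl do rewrite eq_sym; exact: dist_le.
Qed.
End Chain.
End Influence.

(** * Finite propagation speed and the power bound *)

Theorem lemma3 (R : realType) (n : nat) (e : rel 'I_n) (e_sym : symmetric e)
    (Z : 'I_n -> finType)
    (P : state Z -> state Z -> R)
    (Ploc : forall i : 'I_n, local_state Z (nbhd e i) -> Z i -> R)
    (P_pmf : forall x : state Z, is_pmf (P x))
    (Ploc_pmf : forall (i : 'I_n) (u : local_state Z (nbhd e i)),
      is_pmf (Ploc i u))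
    (P_factor : forall x y : state Z,
      P x y = \prod_(i < n) Ploc i (restr (nbhd e i) x) (y i))
    (rho : R)
    (rho_bound : sup (range (fun i : 'I_n => \sum_(j < n) influence Ploc i j))
      <= rho)
    (i : 'I_n) (kappa : nat) (kappa_ge1 : (1 <= kappa)%N)
    (z z' : state Z)
    (zz' : forall j : 'I_n, j \in kappa_nbhd e kappa i -> z j = z' j) :
  (forall t : nat, (t <= kappa)%N ->
     TV (coord_law P z t i) (coord_law P z' t i) = 0) /\
  (forall t : nat, (kappa < t)%N ->
     TV (coord_law P z t i) (coord_law P z' t i) <= rho ^+ t).
Proof.
have le_t := TV_coord_law_le P_pmf Ploc_pmf P_factor z z' _ i.
split=> t tk.
  apply/eqP; rewrite eq_le TV_ge0 andbT (le_trans (le_t t)) //.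
  (* A nonzero entry would put [j] within distance [kappa] of [i], where the initial states
     agree. *)
  rewrite big1 // => j zj; apply/eqP; apply: contraNT zj.
  case/influence_pow_walk=> d dt /(walk_kappa_nbhd (leq_trans dt tk)) jk.
  by apply/eqP/zz'.
have C_rho k : \sum_j influence Ploc k j <= rho.
  exact: le_trans (le_sup_range_fin _ k) rho_bound.
apply: le_trans (le_t t) (le_trans _ (sum_influence_pow_le z i t C_rho)).
(* Entries are nonnegative, so the partial sum is at most the full row sum. *)
rewrite [leRHS](bigID (fun j => z j != z' j)) /= lerDl.
by apply: sumr_ge0 => j _; exact: influence_pow_ge0.
Qed.
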